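(* There do not exist regular graphs whose adjacency matrix has spectrum $\{[11]^1,[2]^{16},[-3]^9,[-4]^4\}$ or $\{[12]^1,[2]^{16},[-3]^8,[-4]^5\}$.
   Context: Graphs are finite, simple and undirected. The notation $[\theta]^k$ in a spectrum means that $\theta$ is an eigenvalue of multiplicity $k$. *)

(* Defs.v *)
From mathcomp Require Import all_boot all_order all_algebra all_field.
Set Implicit Arguments.
Unset Strict Implicit.
Unset Printing Implicit Defensive.
Import GRing.Theory.
Local Open Scope ring_scope.

Record sgraph := SGraph {
  vertex :> finType;
  adj : rel vertex;
  adj_sym : symmetric adj;
  adj_irr : irreflexive adj
}.

Definition degree (G : sgraph) (x : G) : nat := #|[set y | adj x y]|.

Definition regular (G : sgraph) : Prop :=
  exists k : nat, forall x : G, degree x = k.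

(* Vertices are numbered by [enum_val]; the spectrum does not depend on the
   numbering. Entries are taken in [algC], which is algebraically closed, so
   that every eigenvalue of the 0/1 matrix is present. *)
Definition adjmx (G : sgraph) : 'M[algC]_#|G| :=
  \matrix_(i, j) (adj (enum_val i) (enum_val j))%:R.

Definition eig_mult (n : nat) (A : 'M[algC]_n) (theta : algC) : nat :=
  mup theta (char_poly A).

(* The list [:: (theta_1, k_1); ...; (theta_m, k_m)] stands for the spectrum
   {[theta_1]^k_1, ..., [theta_m]^k_m}: the theta_i are distinct, they are all
   the eigenvalues of A, and theta_i has multiplicity k_i. *)
Definition has_spectrum (n : nat) (A : 'M[algC]_n) (s : seq (algC * nat)) :
    Prop :=
  [/\ uniq (unzip1 s),
      forall theta : algC, eigenvalue A theta = (theta \in unzip1 s)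
    & forall (theta : algC) (k : nat),
        (theta, k) \in s -> eig_mult A theta = k].

(* Main.v *)
Require Import Defs.
From mathcomp Require Import all_boot all_order all_algebra all_field.
From mathcomp Require Import zify ring.
Local Open Scope ring_scope.
Set Implicit Arguments.
Unset Strict Implicit.
Unset Printing Implicit Defensive.
Import Order.TTheory GRing.Theory Num.Theory.

(** Let A be the adjacency matrix, J the all-ones matrix and
    q = X^2 + X - 6 = (X - 2)(X + 3). The multiplicities add up to 30 vertices,
    and tr A^2 = 30 k gives the degree k = 11, respectively k = 12.

    As q kills 2 and -3 and q(-4) = 6, the matrix q(A) has eigenvalue q(k) on
    the all-ones vector, 6 on the (-4)-eigenspace and 0 elsewhere. Take
    L = q(A) - t J with t = 4, respectively t = 5: the eigenvalue on the
    all-ones vector becomes 126 - 120 = 6, respectively 150 - 150 = 0, and in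
    both cases L is 6 times a projection of rank 5. It is symmetric and
    integral, with every diagonal entry equal to 1, so each row of L has square
    sum 6, and row sum r = 6, respectively r = 0. Comparing eigenvalues, A L is
    -4 L + 3 J, respectively -4 L, with diagonal -1, respectively -4. But the
    rows of L have too few negative entries for that: the inequality
    2 a y >= y - y^2, for a in {0, 1} and y an integer, summed along a row of A
    and L, gives 2 (A L)_xx >= r - 6, which reads -2 >= 0, respectively
    -8 >= -6.

    Summing over the vertices as well turns every quantity into a trace of a
    polynomial in A, up to terms in J that regularity evaluates
    ([regular_trace_ineq]), and such traces are read off the spectrum
    ([trace_spectrum]). The inequality then says 0 <= -60 for both spectra. *)

Lemma char_poly_conj (F : fieldType) n (P A : 'M[F]_n) :
  P \in unitmx -> char_poly (invmx P *m A *m P) = char_poly A.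
Proof.
move=> Pu; rewrite /char_poly.
have -> : char_poly_mx (invmx P *m A *m P) =
    map_mx polyC (invmx P) *m char_poly_mx A *m map_mx polyC P.
  rewrite /char_poly_mx mulmxBr mulmxBl !map_mxM /=; congr (_ - _).
  by rewrite scalar_mxC -mulmxA -map_mxM mulVmx // map_mx1 mulmx1.
rewrite !det_mulmx mulrAC -det_mulmx -map_mxM mulVmx //.
by rewrite map_mx1 det1 mul1r.
Qed.

(** Passes from the list of all eigenvalues, repetitions included, to the list
    of the distinct ones with their multiplicities. *)
Lemma sum_by_value (V : nmodType) (T : eqType) (r u : seq T) (f : T -> V) :
  uniq u -> {subset r <= u} ->
  \sum_(y <- r) f y = \sum_(a <- u) f a *+ count_mem a r.
Proof.
move=> Uu; elim: r => [_|y r IHr ryu].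
  by rewrite big_nil big1 // => a _; rewrite mulr0n.
have yu : y \in u by apply: ryu; rewrite mem_head.
rewrite big_cons IHr => [|z rz]; last by apply: ryu; rewrite in_cons rz orbT.
under [RHS]eq_bigr do rewrite /= mulrnDr.
rewrite big_split /=; congr (_ + _).
rewrite (bigD1_seq y) //= eqxx big1 ?addr0 // => a /negPf.
by rewrite eq_sym => ->.
Qed.

(** A normal matrix is similar to the diagonal matrix of its eigenvalues, so
    both its characteristic polynomial and the trace of p(A) are given by that
    diagonal, and a multiplicity as a root counts occurrences on it. *)
Lemma trace_spectrum n (A : 'M[algC]_n.+1) (s : seq (algC * nat))
    (p : {poly algC}) :
  A \is normalmx -> has_spectrum A s ->
  \tr (horner_mx A p) = \sum_(x <- s) p.[x.1] *+ x.2.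
Proof.
move=> /orthomx_spectralP; set P := spectralmx A; set d := spectral_diag A.
have Pu : P \in unitmx by apply: spectral_unit.
move=> defA [Us eigA multA]; pose r := [seq d 0 i | i <- enum 'I_n.+1].
have charA : char_poly A = \prod_(x <- r) ('X - x%:P).
  rewrite defA char_poly_conj // char_poly_trig ?diag_mx_is_trig //.
  rewrite big_map big_enum; apply: eq_bigr => i _.
  by rewrite mxE eqxx.
have -> : \tr (horner_mx A p) = \sum_(y <- r) p.[y].
  rewrite {1}defA horner_mx_uconjC // -mulmxA mxtrace_mulC -mulmxA mulmxV //.
  rewrite mulmx1 horner_mx_diag mxtrace_diag big_map big_enum.
  by apply: eq_bigr => i _; rewrite mxE.
rewrite (sum_by_value _ Us) => [|y ry]; last first.
  by rewrite -eigA eigenvalue_root_char charA root_prod_XsubC.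
rewrite big_map !big_seq; apply: eq_bigr => -[a k] /multA <-.
by rewrite /eig_mult charA mu_prod_XsubC.
Qed.

Lemma horner_mx_eigen (R : comNzRingType) n m (A : 'M[R]_n.+1)
    (B : 'M[R]_(n.+1, m)) (c : R) (q : {poly R}) :
  A *m B = c *: B -> horner_mx A q *m B = q.[c] *: B.
Proof.
move=> AB; elim/poly_ind: q => [|q a IHq].
  by rewrite rmorph0 horner0 mul0mx scale0r.
rewrite rmorphD rmorphM /= horner_mx_X horner_mx_C mulmxDl -[_ * A]/(_ *m A).
rewrite -mulmxA AB -scalemxAr IHq mul_scalar_mx scalerA -scalerDl.
by rewrite !hornerE mulrC.
Qed.

Lemma horner_mx_sym (R : comNzRingType) n (A : 'M[R]_n.+1) (q : {poly R}) :
  A^T = A -> (horner_mx A q)^T = horner_mx A q.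
Proof.
move=> symA; elim/poly_ind: q => [|q a IHq].
  by rewrite rmorph0 trmx0.
rewrite rmorphD rmorphM /= horner_mx_X horner_mx_C linearD /= tr_scalar_mx.
congr (_ + _); rewrite -[_ * A]/(_ *m A) trmx_mul IHq symA.
exact: (comm_mx_horner _ (comm_mx_refl A)).
Qed.

(** The left-hand side is y (y - 1) for b = false and y (y + 1) for b = true: a
    product of two consecutive integers. *)
Lemma bool_int_quad (b : bool) (y : int) : 0 <= b%:R * y *+ 2 - y + y ^+ 2.
Proof. case: b; nia. Qed.

Lemma trace_mulmx_sum (R : pzSemiRingType) n (M N : 'M[R]_n) :
  \tr (M *m N) = \sum_i \sum_j M i j * N j i.
Proof. by apply: eq_bigr => i _; rewrite mxE. Qed.

(** [bool_int_quad] summed over all entries of A and of L = q(A) - t J. The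
    trace of q(A) J and those of the other products involving J come from
    A J = k J, and L is symmetric, so that the sum of its squared entries is
    the trace of L^2. *)
Lemma regular_trace_ineq n (e : rel 'I_n.+1) (k : int) (q : {poly int})
    (t : int) :
  let A : 'M[int]_n.+1 := \matrix_(i, j) (e i j)%:R in
  let N : int := n.+1%:R in
  symmetric e -> (forall i, \sum_j A i j = k) ->
  0 <= \tr (horner_mx A ('X * q *+ 2 + q ^+ 2))
       - N * (t * k *+ 2 + q.[k] + t * q.[k] *+ 2) + N ^+ 2 * (t + t ^+ 2).
Proof.
move=> A N syme regA; pose J : 'M[int]_n.+1 := const_mx 1.
have symA : A^T = A by apply/matrixP => i j; rewrite !mxE syme.
have AJ : A *m J = k *: J.
  apply/matrixP => i j; rewrite !mxE -(regA i) mulr1.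
  by apply: eq_bigr => l _; rewrite [J _ _]mxE mulr1.
have JJ : J *m J = N *: J.
  apply/matrixP => i j; rewrite !mxE.
  under eq_bigr do rewrite !mxE mulr1.
  by rewrite sumr_const card_ord mulr1.
have trJ : \tr J = N.
  rewrite /mxtrace; under eq_bigr do rewrite mxE.
  by rewrite sumr_const card_ord.
set B := horner_mx A q.
have BJ : B *m J = q.[k] *: J := horner_mx_eigen q AJ.
pose L := B - t *: J.
have symL : L^T = L.
  by rewrite linearB linearZ /= horner_mx_sym // trmx_const.
have : 0 <= \tr (A *m L) *+ 2 - \tr (L *m J) + \tr (L *m L).
  rewrite !trace_mulmx_sum -sumrMnl -sumrB -big_split; apply: sumr_ge0 => i _.
  rewrite -sumrMnl -sumrB -big_split; apply: sumr_ge0 => j _ /=.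
  have -> : L j i = L i j by rewrite -{1}symL mxE.
  by rewrite [J _ _]mxE mulr1 -expr2 [A _ _]mxE; apply: bool_int_quad.
suff -> : \tr (horner_mx A ('X * q *+ 2 + q ^+ 2)) =
    \tr (A *m B) *+ 2 + \tr (B *m B).
  rewrite /L !(mulmxBl, mulmxBr) -!scalemxAr -!scalemxAl.
  rewrite AJ BJ JJ !raddfB /= !mxtraceZ (mxtrace_mulC J) BJ !mxtraceZ trJ.
  by congr (0 <= _); ring.
by rewrite rmorphD rmorphMn rmorphXn rmorphM /= horner_mx_X raddfD raddfMn.
Qed.

(** Necessary conditions for an integral spectrum to be that of a regular
    graph, for every choice of q and t. The equation, which counts the
    ordered pairs of adjacent vertices as tr A^2, determines k from the
    spectrum. Integral matrices are used
    because [bool_int_quad] needs integers; they only meet the algebraic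
    numbers through traces. *)
Lemma regular_spectrum_ineq n (e : rel 'I_n) (k : int) (s : seq (int * nat))
    (q : {poly int}) (t : int) :
  symmetric e -> (forall i, \sum_j (e i j)%:R = k) ->
  has_spectrum (\matrix_(i, j) (e i j)%:R) [seq (x.1%:~R, x.2) | x <- s] ->
  let N : int := \sum_(x <- s) x.2%:R in N != 0 ->
  N * k = \sum_(x <- s) x.1 ^+ 2 *+ x.2 /\
  0 <= \sum_(x <- s) (x.1 * q.[x.1] *+ 2 + q.[x.1] ^+ 2) *+ x.2
       - N * (t * k *+ 2 + q.[k] + t * q.[k] *+ 2) + N ^+ 2 * (t + t ^+ 2).
Proof.
(* Polynomials are evaluated at matrices of positive size; a matrix of size 0
   has no eigenvalue, which makes N vanish. *)
case: n e => [|n] e syme rege specA N N0.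
  case/negP: N0; rewrite /N big_seq big1 // => x sx.
  have : eigenvalue (\matrix_(i, j) (e i j)%:R : 'M[algC]_0) x.1%:~R.
    by case: specA => _ -> _; apply/mapP; exists (x.1%:~R, x.2); rewrite ?map_f.
  by case/eigenvalueP => v _; rewrite thinmx0 eqxx.
pose A : 'M[int]_n.+1 := \matrix_(i, j) (e i j)%:R.
have regA i : \sum_j A i j = k.
  by rewrite -(rege i); apply: eq_bigr => j _; rewrite mxE.
have trA (p : {poly int}) :
    \tr (horner_mx A p) = \sum_(x <- s) p.[x.1] *+ x.2.
  apply: (@intr_inj algC); rewrite -trace_map_mx map_horner_mx.
  have -> : map_mx intr A = \matrix_(i, j) (e i j)%:R :> 'M[algC]_n.+1.
    by apply/matrixP => i j; rewrite !mxE; case: (e i j).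
  rewrite (trace_spectrum _ _ specA); last first.
    apply: symmetric_normalmx.
      by apply/is_hermitianmxP/matrixP => i j; rewrite !mxE expr0 mul1r syme.
    by apply/mxOverP => i j; rewrite mxE realn.
  rewrite big_map rmorph_sum /=; apply: eq_bigr => x _.
  by rewrite horner_map rmorphMn.
have NE : N = n.+1%:R.
  have := trA 1; rewrite rmorph1 mxtrace1 => ->.
  by apply: eq_bigr => x _; rewrite hornerE.
split.
  have := trA ('X ^+ 2); rewrite rmorphXn /= horner_mx_X.
  under [X in _ = X]eq_bigr do rewrite hornerXn.
  move=> <-; rewrite expr2 -[A * A]/(A *m A) trace_mulmx_sum NE.
  under eq_bigr => i _.
    under eq_bigr => j _.
      have -> : A i j * A j i = A i j by rewrite !mxE syme; case: (e j i).
    over.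
    rewrite regA; over.
  by rewrite sumr_const card_ord mulr_natl.
have := regular_trace_ineq q t syme regA; rewrite trA NE.
by under eq_bigr do rewrite !hornerE.
Qed.

Theorem corollary5p26 :
  ~ exists G : sgraph,
      regular G /\
      (has_spectrum (adjmx G)
         [:: (11, 1%N); (2, 16%N); (-3, 9%N); (-4, 4%N)]
       \/ has_spectrum (adjmx G)
         [:: (12, 1%N); (2, 16%N); (-3, 8%N); (-4, 5%N)]).
Proof.
case=> G [[k degG] specG].
pose e : rel 'I_#|G| := fun i j => adj (enum_val i) (enum_val j).
have syme : symmetric e by move=> i j; apply: adj_sym.
have rege i : \sum_j (e i j)%:R = k%:Z.
  transitivity (\sum_y (adj (enum_val i) y)%:R : int).
    exact/esym/reindex/onW_bij/enum_val_bij.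
  rewrite -natr_sum natz -(degG (enum_val i)) /degree -sum1dep_card.
  by rewrite [in RHS]big_mkcond; congr Posz; apply: eq_bigr => y _; case: adj.
pose q : {poly int} := 'X ^+ 2 + 'X - 6%:P.
have qE x : q.[x] = x ^+ 2 + x - 6 by rewrite !hornerE.
case: specG => specG.
- have := @regular_spectrum_ineq _ e k%:Z
    [:: (11, 1%N); (2, 16%N); (-3, 9%N); (-4, 4%N)] q 4 syme rege specG.
  rewrite !big_cons !big_nil => /(_ isT) [Dk].
  have -> : k%:Z = 11 by apply: (@mulfI _ (30 : int)).
  by rewrite !qE.
- have := @regular_spectrum_ineq _ e k%:Z
    [:: (12, 1%N); (2, 16%N); (-3, 8%N); (-4, 5%N)] q 5 syme rege specG.
  rewrite !big_cons !big_nil => /(_ isT) [Dk].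
  have -> : k%:Z = 12 by apply: (@mulfI _ (30 : int)).
  by rewrite !qE.
Qed.
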